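(* Let $\gamma,\beta>0$, $\dot w=(\dot x,\dot y)\in\mathcal X\times\mathcal Y$, $w=(x,y)\in\mathcal X\times\mathcal Y$, let $G_{\gamma\beta}(w;\dot w)=P_\beta(x;\dot y)-D_\gamma(y;\dot x)$ be the smoothed gap function and let $S_\beta(x;\dot y):=P_\beta(x;\dot y)-P^\star=f(x)+g_\beta(Ax;\dot y)-P^\star$ be the smoothed objective residual. Then, for every primal solution $x^\star\in\mathcal X^\star$ and every dual solution $y^\star\in\mathcal Y^\star$, $$S_\beta(x;\dot y)\le G_{\gamma\beta}(w;\dot w)+\gamma\, b_{\mathcal X}(x^\star,\dot x)\qquad\text{and}\qquad \tfrac12\|y^*_\beta(Ax;\dot y)-y^\star\|_{\mathcal Y}^2\le b_{\mathcal Y}(y^\star,\dot y)+\tfrac1\beta S_\beta(x;\dot y).$$ Suppose moreover that $g=\delta_{\{c\}}$ is the indicator function of $\{c\}$ for some $c\in\mathbb R^m$, so that the primal problem is $f^\star:=\min\{f(x)\mid Ax=c\}$. Then, for any $y^\star\in\mathcal Y^\star$ and $x\in\mathcal X$, $$-\|y^\star\|_{\mathcal Y}\,\|Ax-c\|_{\mathcal Y,*}\le f(x)-f^\star,$$ and $$f(x)-f^\star\le S_\beta(x;\dot y)-\langle y^\star,Ax-c\rangle+\beta\, b_{\mathcal Y}(y^\star,\dot y),$$ $$\|Ax-c\|_{\mathcal Y,*}\le \beta L_{b_{\mathcal Y}}\Big[\|y^\star-\dot y\|_{\mathcal Y}+\big(\|y^\star-\dot y\|_{\mathcal Y}^2+2L_{b_{\mathcal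 Y}}^{-1}\beta^{-1}S_\beta(x;\dot y)\big)^{1/2}\Big],$$ where the quantity under the square root is always nonnegative.
   Context: Setting. $f:\mathbb R^n\to\mathbb R\cup\{+\infty\}$ and $g:\mathbb R^m\to\mathbb R\cup\{+\infty\}$ are proper, closed, convex, and $A\in\mathbb R^{m\times n}$. Primal problem: $P^\star=\min_{x\in\mathbb R^n}\{P(x):=f(x)+g(Ax)\}$, with solution set $\mathcal X^\star$. Dual problem: $D^\star=\max_{y\in\mathbb R^m}\{D(y):=-f^*(-A^\top y)-g^*(y)\}$, with solution set $\mathcal Y^\star$; $f^*,g^*$ are Fenchel conjugates. Put $\mathcal X:=\overline{\mathrm{dom}(f)}$, $\mathcal Y:=\overline{\mathrm{dom}(g^* )}$. Standing assumption: $\mathcal X^\star\ne\emptyset$ and $0\in\mathrm{ri}(\mathrm{dom}(g)-A(\mathrm{dom} f))$ (when $g=\delta_{\{c\}}$: the Slater condition $\mathrm{ri}(\mathrm{dom} f)\cap\{x: Ax=c\}\neq\emptyset$). Under it strong duality $P^\star=D^\star$ holds and $\mathcal Y^\star\neq\emptyset$. Norms. $\|\cdot\|_{\mathcal X}$ and $\|\cdot\|_{\mathcal Y}$ are weighted Euclidean norms on $\mathbb R^n$ and $\mathbb R^m$ (of the form $\|z\|=\|Sz\|_2$ with $S^\top S$ positive definite), with dual norms $\|u\|_{\cdot,*}=\max\{\langle u,v\rangle:\|v\|=1\}$ with respect to the standard inner product. Bregman distances. For $\mathcal Z\in\{\mathcal X,\mathcal Y\}$, $p_{\mathcal Z}$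 is a continuous prox-function with $\mathcal Z\subseteq\mathrm{dom}(p_{\mathcal Z})$ which is $1$-strongly convex and differentiable with Lipschitz gradient with respect to $\|\cdot\|_{\mathcal Z}$, and $b_{\mathcal Z}(z,\dot z):=p_{\mathcal Z}(z)-p_{\mathcal Z}(\dot z)-\langle\nabla p_{\mathcal Z}(\dot z),z-\dot z\rangle$. $L_{b_{\mathcal Y}}\ge1$ is a Lipschitz constant of $\nabla b_{\mathcal Y}(\cdot,\dot y)$ (equivalently of $\nabla p_{\mathcal Y}$), from $\|\cdot\|_{\mathcal Y}$ to $\|\cdot\|_{\mathcal Y,*}$. Smoothed functions. $D_\gamma(y;\dot x):=\min_{x\in\mathcal X}\{f(x)+\langle y,Ax\rangle+\gamma b_{\mathcal X}(x,\dot x)\}-g^*(y)$; $g_\beta(u;\dot y):=\max_{y\in\mathcal Y}\{\langle u,y\rangle-g^*(y)-\beta b_{\mathcal Y}(y,\dot y)\}$, whose unique maximizer is denoted $y^*_\beta(u;\dot y)$; $P_\beta(x;\dot y):=f(x)+g_\beta(Ax;\dot y)$. *)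

(* Defs.v *)
From HB Require Import structures.
From mathcomp Require Import all_boot all_order all_algebra.
From mathcomp Require Import all_classical all_reals all_analysis.

Set Implicit Arguments.
Unset Strict Implicit.
Unset Printing Implicit Defensive.

Import Order.TTheory GRing.Theory Num.Theory.
Import numFieldNormedType.Exports.

Local Open Scope classical_set_scope.
Local Open Scope ring_scope.

(* The topology of 'cV[R]_n in the library is that of the sup norm, i.e. the
   usual topology of R^n. *)

Definition dotv {R : realType} {n : nat} (u v : 'cV[R]_n) : R :=
  \sum_(i < n) u i 0 * v i 0.

Definition norm2 {R : realType} {n : nat} (u : 'cV[R]_n) : R :=
  Num.sqrt (dotv u u).

Definition posdefmx {R : realType} {n : nat} (M : 'M[R]_n) : Prop :=
  M^T = M /\ forall v : 'cV[R]_n, v != 0 -> 0 < dotv v (M *m v).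

Definition wnorm {R : realType} {k n : nat} (S : 'M[R]_(k, n))
  (z : 'cV[R]_n) : R := norm2 (S *m z).

(* When n > 0 and S^T S is positive definite, the supremum is a maximum;
   for n = 0 the set is empty and its supremum is 0. *)
Definition dual_wnorm {R : realType} {k n : nat} (S : 'M[R]_(k, n))
  (u : 'cV[R]_n) : R :=
  sup [set dotv u v | v in [set v : 'cV[R]_n | wnorm S v = 1]].

Definition edom {R : realType} {n : nat} (f : 'cV[R]_n -> \bar R) :
  set 'cV[R]_n := [set x | (f x < +oo)%E].

Definition epigraph {R : realType} {n : nat} (f : 'cV[R]_n -> \bar R) :
  set ('cV[R]_n * R^o) := [set z | (f z.1 <= (z.2 : R)%:E)%E].

Definition proper_fun {R : realType} {n : nat} (f : 'cV[R]_n -> \bar R) : Prop :=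
  (forall x, -oo < f x)%E /\ edom f !=set0.

Definition closed_fun {R : realType} {n : nat} (f : 'cV[R]_n -> \bar R) : Prop :=
  closed (epigraph f).

Definition convex_fun {R : realType} {n : nat} (f : 'cV[R]_n -> \bar R) : Prop :=
  convex_set (epigraph f).

Definition fconj {R : realType} {n : nat} (f : 'cV[R]_n -> \bar R)
  (u : 'cV[R]_n) : \bar R :=
  ereal_sup (range (fun x : 'cV[R]_n => ((dotv u x)%:E - f x)%E)).

Definition delta {R : realType} {n : nat} (C : set 'cV[R]_n) (u : 'cV[R]_n) :
  \bar R := if u \in C then 0%E else +oo%E.

Definition aff {R : realType} {n : nat} (C : set 'cV[R]_n) : set 'cV[R]_n :=
  [set x | exists (k : nat) (a : 'I_k -> R) (v : 'I_k -> 'cV[R]_n),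
    [/\ forall i, C (v i), \sum_(i < k) a i = 1
      & x = \sum_(i < k) a i *: v i]].

Definition ri {R : realType} {n : nat} (C : set 'cV[R]_n) : set 'cV[R]_n :=
  [set x | aff C x /\ \forall z \near x, aff C z -> C z].

Definition primal_obj {R : realType} {m n : nat} (f : 'cV[R]_n -> \bar R)
  (g : 'cV[R]_m -> \bar R) (A : 'M[R]_(m, n)) (x : 'cV[R]_n) : \bar R :=
  (f x + g (A *m x))%E.

Definition dual_obj {R : realType} {m n : nat} (f : 'cV[R]_n -> \bar R)
  (g : 'cV[R]_m -> \bar R) (A : 'M[R]_(m, n)) (y : 'cV[R]_m) : \bar R :=
  (- fconj f (- (A^T *m y)) - fconj g y)%E.

Definition primal_val {R : realType} {m n : nat} (f : 'cV[R]_n -> \bar R)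
  (g : 'cV[R]_m -> \bar R) (A : 'M[R]_(m, n)) : \bar R :=
  ereal_inf (range (primal_obj f g A)).

Definition primal_sol {R : realType} {m n : nat} (f : 'cV[R]_n -> \bar R)
  (g : 'cV[R]_m -> \bar R) (A : 'M[R]_(m, n)) : set 'cV[R]_n :=
  [set x | forall x', (primal_obj f g A x <= primal_obj f g A x')%E].

Definition dual_sol {R : realType} {m n : nat} (f : 'cV[R]_n -> \bar R)
  (g : 'cV[R]_m -> \bar R) (A : 'M[R]_(m, n)) : set 'cV[R]_m :=
  [set y | forall y', (dual_obj f g A y' <= dual_obj f g A y)%E].

(* For an equality constraint the condition is the Slater condition. *)
Definition qualification {R : realType} {m n : nat} (f : 'cV[R]_n -> \bar R)
  (g : 'cV[R]_m -> \bar R) (A : 'M[R]_(m, n)) : Prop :=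
  ri [set u - A *m x | u in edom g & x in edom f] 0 \/
  exists c : 'cV[R]_m,
    g = delta [set c] /\ ri (edom f) `&` [set x | A *m x = c] !=set0.

(* Only meaningful at interior points of edom p, where p is locally finite. *)
Definition grad {R : realType} {n : nat} (p : 'cV[R]_n -> \bar R)
  (z : 'cV[R]_n) : 'cV[R]_n :=
  \col_(i < n) 'D_(delta_mx i 0) (fine \o p : 'cV[R]_n -> R^o) z.

Definition differentiable_fun_at {R : realType} {n : nat}
  (p : 'cV[R]_n -> \bar R) (z : 'cV[R]_n) : Prop :=
  (edom p)° z /\ differentiable (fine \o p : 'cV[R]_n -> R^o) z.

Definition strongly_convex1 {R : realType} {k n : nat} (S : 'M[R]_(k, n))
  (p : 'cV[R]_n -> \bar R) : Prop :=
  forall (z z' : 'cV[R]_n) (t : R), 0 <= t <= 1 ->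
    (p (t *: z + (1 - t) *: z')%R
       + ((2^-1 * t * (1 - t) * wnorm S (z - z') ^+ 2)%R)%:E
     <= t%:E * p z + ((1 - t)%R)%:E * p z')%E.

Definition prox_function {R : realType} {k n : nat} (S : 'M[R]_(k, n))
  (Z : set 'cV[R]_n) (L : R) (p : 'cV[R]_n -> \bar R) : Prop :=
  [/\ forall z, (-oo < p z)%E,
      Z `<=` edom p /\ {within edom p, continuous p},
      strongly_convex1 S p,
      forall z, Z z -> differentiable_fun_at p z &
      forall z z', Z z -> Z z' ->
        dual_wnorm S (grad p z - grad p z') <= L * wnorm S (z - z')].

Definition bregman {R : realType} {n : nat} (p : 'cV[R]_n -> \bar R)
  (z z0 : 'cV[R]_n) : \bar R :=
  (p z - p z0 - (dotv (grad p z0) (z - z0))%:E)%E.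

Definition smooth_dual {R : realType} {m n : nat} (f : 'cV[R]_n -> \bar R)
  (g : 'cV[R]_m -> \bar R) (A : 'M[R]_(m, n)) (pX : 'cV[R]_n -> \bar R)
  (gamma : R) (y : 'cV[R]_m) (xdot : 'cV[R]_n) : \bar R :=
  (ereal_inf [set f x + (dotv y (A *m x))%:E + gamma%:E * bregman pX x xdot
             | x in closure (edom f)]
   - fconj g y)%E.

Definition smooth_g_obj {R : realType} {m : nat} (g pY : 'cV[R]_m -> \bar R)
  (beta : R) (u ydot y : 'cV[R]_m) : \bar R :=
  ((dotv u y)%:E - fconj g y - beta%:E * bregman pY y ydot)%E.

Definition smooth_g {R : realType} {m : nat} (g pY : 'cV[R]_m -> \bar R)
  (beta : R) (u ydot : 'cV[R]_m) : \bar R :=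
  ereal_sup [set smooth_g_obj g pY beta u ydot y
            | y in closure (edom (fconj g))].

(* [get] picks an element of the set of maximizers. *)
Definition smooth_g_argmax {R : realType} {m : nat} (g pY : 'cV[R]_m -> \bar R)
  (beta : R) (u ydot : 'cV[R]_m) : 'cV[R]_m :=
  get [set y | closure (edom (fconj g)) y /\
    forall y', closure (edom (fconj g)) y' ->
      (smooth_g_obj g pY beta u ydot y' <= smooth_g_obj g pY beta u ydot y)%E].

Definition smooth_primal {R : realType} {m n : nat} (f : 'cV[R]_n -> \bar R)
  (g : 'cV[R]_m -> \bar R) (A : 'M[R]_(m, n)) (pY : 'cV[R]_m -> \bar R)
  (beta : R) (x : 'cV[R]_n) (ydot : 'cV[R]_m) : \bar R :=
  (f x + smooth_g g pY beta (A *m x) ydot)%E.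

Definition smooth_gap {R : realType} {m n : nat} (f : 'cV[R]_n -> \bar R)
  (g : 'cV[R]_m -> \bar R) (A : 'M[R]_(m, n)) (pX : 'cV[R]_n -> \bar R)
  (pY : 'cV[R]_m -> \bar R) (gamma beta : R)
  (w wdot : 'cV[R]_n * 'cV[R]_m) : \bar R :=
  (smooth_primal f g A pY beta w.1 wdot.2
   - smooth_dual f g A pX gamma w.2 wdot.1)%E.

Definition smooth_resid {R : realType} {m n : nat} (f : 'cV[R]_n -> \bar R)
  (g : 'cV[R]_m -> \bar R) (A : 'M[R]_(m, n)) (pY : 'cV[R]_m -> \bar R)
  (beta : R) (x : 'cV[R]_n) (ydot : 'cV[R]_m) : \bar R :=
  (smooth_primal f g A pY beta x ydot - primal_val f g A)%E.

(* Main.v *)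
Require Import Defs.
From HB Require Import structures.
From mathcomp Require Import all_boot all_order all_algebra.
From mathcomp Require Import all_classical all_reals all_analysis.
From mathcomp Require Import ring lra.

Import Order.TTheory GRing.Theory Num.Theory.
Import numFieldNormedType.Exports.

Local Open Scope classical_set_scope.
Local Open Scope ring_scope.

(** Write [p] for the optimal value, [b] for the Bregman distance of the dual
    prox-function, [S] for the smoothed residual at [x], and [phi] for the
    concave function whose supremum over [y] is the smoothed [g] at [A *m x].

    The first inequality is weak: evaluating the infimum that defines the
    smoothed dual at [xstar] and applying the Fenchel-Young inequality to [g]
    shows that the smoothed dual at [y] is at most [p + gamma * b_X], with
    [b_X] the Bregman distance from [xdot] to [xstar]. Subtracting both sides
    from the smoothed primal gives the bound on [S] ([lee_gap]).

    Everything else says that a dual solution [ystar] is a Lagrange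
    multiplier, [p + g^*(ystar) <= f x + <ystar, A x>] for all [x]
    ([dual_sol_multiplier]). This is where strong duality enters: the
    qualification makes [0] an algebraic relative interior point of the domain
    of the perturbed value function [u |-> inf_x f x + g (A x + u)]
    ([qualification_core]), so this convex function has a subgradient there,
    built one coordinate at a time ([subgradient_exists]), and that
    subgradient attains [p] in the dual ([strong_duality]). Consequently a
    lower bound on the smoothed [g] turns into a lower bound on [S]
    ([smooth_resid_ge]), and only the point at which [phi] is evaluated
    changes:
    - growing quadratically away from its maximizer, [phi] satisfies
      [phi ystar + beta / 2 * ||ymax - ystar||^2 <= max phi]
      ([smooth_g_growth]), which gives the bound on the distance from the
      maximizer to [ystar]. That the maximizer exists follows from the
      completeness of the space, since maximizing sequences of a strongly
      concave function are Cauchy ([strongly_concave_argmax]);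
    - when [g] is the indicator function of [c], [g^*] is the linear form
      [<c, _>], and evaluating [phi] at [ystar] bounds [f x - fstar];
    - in the same case the Lipschitz gradient gives
      [b y ydot <= L / 2 * ||y - ydot||^2] ([rbregman_le]). Evaluating [phi] at
      [ydot] moved in the direction dual to [A x - c] then gives
      [rho^2 / (2 * beta * L) - rho * ||ystar - ydot|| <= S] with [rho] the
      dual norm of [A x - c]. Completing the square yields both the sign of
      the radicand and the bound on [rho] ([quadratic_bound]). *)

(** * Inner products, weighted norms and their duals *)

Section InnerProduct.
Context {R : realType} {n : nat}.
Implicit Types (u v w : 'cV[R]_n) (a : R).

Lemma dotvC u v : dotv u v = dotv v u.
Proof. by apply: eq_bigr => i _; rewrite mulrC. Qed.

Lemma dotvDr u v w : dotv u (v + w) = dotv u v + dotv u w.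
Proof. by rewrite -big_split; apply: eq_bigr => i _; rewrite mxE mulrDr. Qed.

Lemma dotvZr a u v : dotv u (a *: v) = a * dotv u v.
Proof. by rewrite mulr_sumr; apply: eq_bigr => i _; rewrite mxE mulrCA. Qed.

Lemma dotvNr u v : dotv u (- v) = - dotv u v.
Proof. by rewrite -scaleN1r dotvZr mulN1r. Qed.

Lemma dotvBr u v w : dotv u (v - w) = dotv u v - dotv u w.
Proof. by rewrite dotvDr dotvNr. Qed.

Lemma dotvDl u v w : dotv (u + v) w = dotv u w + dotv v w.
Proof. by rewrite dotvC dotvDr !(dotvC w). Qed.

Lemma dotvZl a u v : dotv (a *: u) v = a * dotv u v.
Proof. by rewrite dotvC dotvZr dotvC. Qed.

Lemma dotvNl u v : dotv (- u) v = - dotv u v.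
Proof. by rewrite dotvC dotvNr dotvC. Qed.

Lemma dotvBl u v w : dotv (u - v) w = dotv u w - dotv v w.
Proof. by rewrite dotvDl dotvNl. Qed.

Lemma dotv0r u : dotv u 0 = 0.
Proof. by rewrite -(scale0r 0) dotvZr mul0r. Qed.

Lemma dotv0l u : dotv 0 u = 0.
Proof. by rewrite dotvC dotv0r. Qed.

Lemma dotv_delta u i : dotv u (delta_mx i 0) = u i 0.
Proof.
rewrite /dotv (bigD1 i)//= !mxE !eqxx mulr1 big1 ?addr0// => j ji.
by rewrite !mxE (negbTE ji) mulr0.
Qed.

Lemma dotv_ge0 u : 0 <= dotv u u.
Proof. by apply: sumr_ge0 => i _; rewrite -expr2 sqr_ge0. Qed.

Lemma norm2_ge0 u : 0 <= norm2 u. Proof. exact: sqrtr_ge0. Qed.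

Lemma norm2_sqr u : norm2 u ^+ 2 = dotv u u.
Proof. by rewrite /norm2 sqr_sqrtr// dotv_ge0. Qed.

Lemma norm2Z a u : norm2 (a *: u) = `|a| * norm2 u.
Proof.
by rewrite /norm2 dotvZl dotvZr mulrA -expr2 sqrtrM ?sqr_ge0// sqrtr_sqr.
Qed.


Lemma dotv_eq0 u : dotv u u = 0 -> u = 0.
Proof.
move=> /eqP; rewrite psumr_eq0; last by move=> i _; rewrite -expr2 sqr_ge0.
move=> /allP u0; apply/matrixP => i j; rewrite (ord1 j) mxE.
have := u0 i (mem_index_enum _); rewrite /= mulf_eq0 orbb.
by move/eqP.
Qed.

(** Expand the square of the component of [v] orthogonal to [u]. *)
Lemma cauchy_schwarz u v : dotv u v <= norm2 u * norm2 v.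
Proof.
have [->|u0] := eqVneq u 0; first by rewrite dotv0l mulr_ge0 ?norm2_ge0.
have uu : 0 < dotv u u.
  by rewrite lt_neqAle dotv_ge0 andbT eq_sym; apply: contra_neq u0 => /dotv_eq0.
have := dotv_ge0 (dotv u u *: v - dotv u v *: u).
rewrite !(dotvBl, dotvBr, dotvZl, dotvZr) (dotvC v u).
have -> : forall a b c : R,
  a * (a * c - b * b) - b * (a * b - b * a) = a * (a * c - b ^+ 2).
  by move=> *; ring.
rewrite pmulr_rge0// subr_ge0 -!norm2_sqr -exprMn => h.
apply: le_trans (ler_norm _) _; rewrite -(ler_pXn2r (n := 2))//.
- by rewrite -normrX ger0_norm ?sqr_ge0.
- by rewrite nnegrE mulr_ge0 ?norm2_ge0.
Qed.

End InnerProduct.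

Lemma dotv_mulmx {R : realType} {m n : nat} (A : 'M[R]_(m, n)) x y :
  dotv (A *m x) y = dotv x (A^T *m y).
Proof.
have dE k (u v : 'cV[R]_k) : dotv u v = (u^T *m v) 0 0.
  by rewrite mxE; apply: eq_bigr => i _; rewrite mxE.
by rewrite !dE trmx_mul mulmxA.
Qed.

Section WeightedNorm.
Context {R : realType} {k n : nat} (S : 'M[R]_(k, n)).
Implicit Types (u v : 'cV[R]_n).

Lemma wnorm_ge0 v : 0 <= wnorm S v. Proof. exact: norm2_ge0. Qed.

Lemma wnormZ a v : wnorm S (a *: v) = `|a| * wnorm S v.
Proof. by rewrite /wnorm -scalemxAr norm2Z. Qed.

Lemma wnormN v : wnorm S (- v) = wnorm S v.
Proof. by rewrite -scaleN1r wnormZ normrN1 mul1r. Qed.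

Hypothesis SP : posdefmx (S^T *m S).

Lemma posdefmx_unit (M : 'M[R]_n) : posdefmx M -> M \in unitmx.
Proof.
case=> Msym Mpos; rewrite unitmxE unitfE; apply/negP => /det0P[v v0 vM].
have vT0 : v^T != 0 by rewrite -(inj_eq trmx_inj) trmxK trmx0.
have := Mpos _ vT0.
have -> : M *m v^T = 0 by rewrite -Msym -trmx_mul vM trmx0.
by rewrite dotv0r ltxx.
Qed.

Lemma wnorm_eq0 v : wnorm S v = 0 -> v = 0.
Proof.
move=> v0; apply: contraPeq v0 => /(proj2 SP).
rewrite -mulmxA dotvC dotv_mulmx trmxK -norm2_sqr => /gt_eqF/negbT.
by rewrite sqrf_eq0 => /eqP.
Qed.

(** The representative of the linear form [dotv u] for the inner product
    defined by [S^T *m S]; its weighted norm is the dual norm of [u]. *)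
Definition riesz u : 'cV[R]_n := invmx (S^T *m S) *m u.

Lemma rieszE u v : dotv u v = dotv (S *m riesz u) (S *m v).
Proof.
rewrite (dotvC (S *m riesz u)) dotv_mulmx mulmxA /riesz mulmxA mulmxV.
  by rewrite mul1mx dotvC.
exact: posdefmx_unit.
Qed.

(** Cauchy-Schwarz for the weighted inner product, with equality at the
    normalized representative. When the representative vanishes, the supremum
    is over [{0}], or over the empty set in dimension [0]. *)
Lemma dual_wnormE u : dual_wnorm S u = wnorm S (riesz u).
Proof.
have ub : ubound [set dotv u v | v in [set v | wnorm S v = 1]]
    (wnorm S (riesz u)).
  move=> _ [v /= v1 <-]; rewrite rieszE -[leRHS]mulr1 -v1.
  exact: cauchy_schwarz.
have [u0|u0] := eqVneq (wnorm S (riesz u)) 0.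
  rewrite u0; rewrite /dual_wnorm.
  have [->|] := eqVneq [set dotv u v | v in [set v | wnorm S v = 1]] set0.
    exact: sup0.
  case/set0P => _ [v /= v1 _].
  apply/eqP; rewrite eq_le; apply/andP; split.
    by rewrite -u0; apply: ge_sup => //; exists (dotv u v), v.
  have -> : 0 = dotv u v by rewrite rieszE (wnorm_eq0 _ u0) mulmx0 dotv0l.
  apply: ub_le_sup; last by exists v.
  by exists (wnorm S (riesz u)).
set a := wnorm S (riesz u) in u0 ub *.
have maxi : [set dotv u v | v in [set v | wnorm S v = 1]] a.
  exists (a^-1 *: riesz u) => /=.
    by rewrite wnormZ normfV ger0_norm ?wnorm_ge0// mulVf//.
  by rewrite dotvZr rieszE -norm2_sqr -[norm2 _]/a expr2 mulrA mulVf// mul1r.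
apply/eqP; rewrite eq_le; apply/andP; split.
- by rewrite /dual_wnorm; apply: ge_sup => //; exists a.
- by rewrite /dual_wnorm; apply: ub_le_sup => //; exists a.
Qed.

Lemma dual_wnorm_ge0 u : 0 <= dual_wnorm S u.
Proof. by rewrite dual_wnormE wnorm_ge0. Qed.

Lemma dotv_le_dual u v : dotv u v <= dual_wnorm S u * wnorm S v.
Proof. by rewrite dual_wnormE rieszE cauchy_schwarz. Qed.

Lemma dual_wnorm_attained u :
  exists2 v, wnorm S v = dual_wnorm S u & dotv u v = dual_wnorm S u ^+ 2.
Proof.
exists (riesz u); first by rewrite dual_wnormE.
by rewrite rieszE -norm2_sqr dual_wnormE.
Qed.

(** Each coordinate is a linear form, hence bounded by its dual norm; this is
    half of the equivalence of norms in finite dimension. *)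
Lemma norm_le_wnorm : exists2 C, 0 < C & forall v, `|v| <= C * wnorm S v.
Proof.
pose c (i : 'I_n) := dual_wnorm S (delta_mx i 0).
have c0 i : 0 <= c i by exact: dual_wnorm_ge0.
exists (1 + \sum_i c i); first by rewrite ltr_pwDl// sumr_ge0.
move=> v; rewrite [leLHS]mx_normrE; apply: bigmax_le.
  by rewrite mulr_ge0 ?wnorm_ge0// addr_ge0// sumr_ge0.
move=> [i j] _ /=; rewrite (ord1 j).
have ci (w : 'cV[R]_n) : w i 0 <= (1 + \sum_i c i) * wnorm S w.
  rewrite -dotv_delta dotvC; apply: le_trans (dotv_le_dual _ _) _.
  rewrite ler_wpM2r ?wnorm_ge0// (bigD1 i)//= addrCA lerDl.
  by rewrite addr_ge0// sumr_ge0.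
by rewrite ler_norml ci lerNl andbT -(wnormN v); have := ci (- v); rewrite mxE.
Qed.

End WeightedNorm.

(** * Subgradients of convex functions on R^m *)

Lemma convex_funP {R : realType} {n : nat} (f : 'cV[R]_n -> \bar R) :
  convex_fun f -> forall x y a b (t : R), 0 <= t <= 1 ->
  (f x <= a%:E)%E -> (f y <= b%:E)%E ->
  (f (t *: x + (1 - t) *: y)%R <= (t * a + (1 - t) * b)%R%:E)%E.
Proof.
move=> cf x y a b t /andP[t0 t1] fa fb.
have tI : Itv.spec (@Itv.num_sem R) (Itv.Real `[0%Z, 1%Z]) t.
  by rewrite /Itv.spec /= /Itv.num_sem/= ger0_real//= in_itv /= t0 t1.
have := cf (x, a) (y, b) (Itv.mk tI).
by rewrite !inE /epigraph/=; exact.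
Qed.

(** A convex function [u |-> inf {r | K u r}] with values in the extended reals
    is given here by a convex relation [K], which spares any computation with
    infinite values. The hypothesis [K_core] puts [0] in the algebraic relative
    interior of its domain: every direction of the domain can be followed
    backwards from [0]. *)
Section Subgradient.
Context {R : realType} {m : nat} (K : 'cV[R]_m -> R -> Prop) (p : R).
Hypothesis K_convex : forall u r u' r' (t : R), 0 <= t <= 1 ->
  K u r -> K u' r' -> K (t *: u + (1 - t) *: u') (t * r + (1 - t) * r').
Hypothesis K_above : forall r, K 0 r -> p <= r.
Hypothesis K_core : forall u r, K u r ->
  exists e r', 0 < e /\ K (- (e *: u)) r'.

(** One step of the Hahn-Banach argument. A minorant valid on the vectors
    supported on the first [k] coordinates extends to one more coordinate with
    slope [a] if and only if [a] separates the quotients [q u r] with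
    [u k 0 < 0] from those with [u k 0 > 0]. Convexity orders the two
    families, since a segment joining both sides crosses [u k 0 = 0]; by
    [K_core] they are both empty or both nonempty, so that a real [a]
    exists. *)
Lemma subgradient_step (k : 'I_m) y :
  (forall u r, K u r -> (forall i : 'I_m, (k <= i)%N -> u i 0 = 0) ->
     p + dotv y u <= r) ->
  exists y', forall u r, K u r ->
     (forall i : 'I_m, (k < i)%N -> u i 0 = 0) -> p + dotv y' u <= r.
Proof.
move=> IH.
pose T u r := K u r /\ forall i : 'I_m, (k < i)%N -> u i 0 = 0.
pose q u r := (r - p - dotv y u) / u k 0.
have key u r u' r' : T u r -> T u' r' -> u k 0 < 0 -> 0 < u' k 0 ->
    q u r <= q u' r'.
  move=> [Ku Tu] [Ku' Tu'] uk uk'.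
  have d0 : 0 < u' k 0 - u k 0 by lra.
  (* The weight for which the k-th coordinate of the combination vanishes. *)
  pose t := u' k 0 / (u' k 0 - u k 0).
  have tE : 1 - t = - u k 0 / (u' k 0 - u k 0).
    by rewrite /t; field; rewrite gt_eqF.
  have t01 : 0 <= t <= 1.
    rewrite -[t <= 1]subr_ge0 tE; apply/andP; split; apply: divr_ge0; lra.
  have := IH _ _ (K_convex _ _ _ _ _ t01 Ku Ku').
  rewrite dotvDr !dotvZr => h.
  have {}h : p + (t * dotv y u + (1 - t) * dotv y u') <= t * r + (1 - t) * r'.
    apply: h => i; rewrite leq_eqVlt => /orP[/eqP ki|ki].
      have {ki} -> : i = k by apply: val_inj.
      by rewrite !mxE tE /t; field; rewrite gt_eqF.
    by rewrite !mxE Tu// Tu'// !mulr0 addr0.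
  rewrite -subr_ge0 in h.
  have {}h : 0 <= (u' k 0 * (r - p - dotv y u) - u k 0 * (r' - p - dotv y u'))
               / (u' k 0 - u k 0).
    move: h; rewrite tE /t; congr (_ <= _); field; rewrite gt_eqF//.
  rewrite pmulr_lge0 ?invr_gt0// in h.
  rewrite /q ler_pdivlMr// mulrAC ler_ndivrMr//. lra.
have flip u r : T u r -> u k 0 != 0 ->
    exists u' r', T u' r' /\ u' k 0 * u k 0 < 0.
  move=> [Ku Tu] uk; have [e [r' [e0 Ke]]] := K_core _ _ Ku.
  exists (- (e *: u)), r'; split; first split=> // i ki.
    by rewrite !mxE Tu// mulr0 oppr0.
  by rewrite !mxE mulNr -mulrA oppr_lt0 mulr_gt0// -expr2 exprn_even_gt0.
have [a aP] : exists a, forall u r, T u r ->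
    (u k 0 < 0 -> q u r <= a) /\ (0 < u k 0 -> a <= q u r).
  pose L := [set q ur.1 ur.2 | ur in [set ur | T ur.1 ur.2 /\ ur.1 k 0 < 0]].
  have [L0|] := pselect (L !=set0); last first.
    move=> L0; exists 0 => u r Tur; split=> uk; exfalso; apply: L0.
      by exists (q u r), (u, r).
    have [u' [r' [Tur' uk']]] := flip _ _ Tur (lt0r_neq0 uk).
    exists (q u' r'), (u', r') => //; split => //=.
    by rewrite pmulr_llt0 in uk'.
  exists (sup L) => u r Tur; split=> uk.
    apply: ub_le_sup; last by exists (u, r).
    have [u' [r' [Tur' uk']]] := flip _ _ Tur (ltr0_neq0 uk).
    rewrite nmulr_llt0// in uk'.
    by exists (q u' r') => _ [[v s] /= [Tvs vk] <-]; exact: key.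
  by apply: ge_sup => // _ [[v s] /= [Tvs vk] <-]; exact: key.
exists (y + a *: delta_mx k 0) => u r Ku Tu.
rewrite dotvDl dotvZl (dotvC (delta_mx k 0)) dotv_delta.
have [alow aup] := aP u r (conj Ku Tu).
have [uk|uk|uk] := ltgtP (u k 0) 0.
- have := alow uk; rewrite /q ler_ndivrMr//; lra.
- have := aup uk; rewrite /q ler_pdivlMr//; lra.
- rewrite uk mulr0 addr0; apply: IH => // i; rewrite leq_eqVlt => /orP[/eqP ki|].
    by have -> : i = k by apply: val_inj.
  exact: Tu.
Qed.

Lemma subgradient_exists : exists y, forall u r, K u r -> p + dotv y u <= r.
Proof.
suff H k : (k <= m)%N -> exists y, forall u r, K u r ->
    (forall i : 'I_m, (k <= i)%N -> u i 0 = 0) -> p + dotv y u <= r.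
  have [y yP] := H m (leqnn m).
  by exists y => u r Ku; apply: yP => // i; rewrite leqNgt ltn_ord.
elim: k => [_|k IH km].
  exists 0 => u r Ku u0; rewrite dotv0l addr0; apply: K_above.
  by have -> // : 0 = u; apply/matrixP => i j; rewrite (ord1 j) mxE u0.
have [y yP] := IH (ltnW km).
exact: (subgradient_step (Ordinal km) y).
Qed.

End Subgradient.

Lemma ri_sub {R : realType} {n : nat} (C : set 'cV[R]_n) x : ri C x -> C x.
Proof. by move=> [ax /nbhs_singleton]; exact. Qed.

(** Points slightly beyond [x] on the line from [y] through [x] lie in the
    affine hull and near [x]. *)
Lemma ri_prolong {R : realType} {n : nat} (C : set 'cV[R]_n) x y :
  ri C x -> C y -> exists2 e : R, 0 < e & C (x + e *: (x - y)).
Proof.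
move=> riC Cy; have Cx := ri_sub _ _ riC; case: riC => _ Cnear.
have cont : (fun e : R => x + e *: (x - y)) e @[e --> 0^'+] --> x.
  apply: cvg_at_right_filter.
  rewrite -[X in _ --> X]addr0 -(scale0r (x - y)).
  by apply: cvgD; [exact: cvg_cst|apply: cvgZr_tmp; exact: cvg_id].
have := cont _ Cnear; rewrite near_simpl/= => near_e.
have pos : \forall e \near (0:R)^'+, 0 < e by exact: nbhs_right_gt.
have [e [e0]] := filter_ex (filterI pos near_e).
move=> h; exists e => //; apply: h.
exists 2%N, (fun i => if i == 0 then 1 + e else - e),
  (fun i => if i == 0 then x else y); split.
- by move=> i; case: ifP.
- by rewrite !big_ord_recl big_ord0 /=; ring.
- rewrite !big_ord_recl big_ord0 /= addr0 scalerBr scalerDl scale1r scaleNr.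
  by rewrite addrA.
Qed.

(** * Conjugates and strong duality *)

Lemma proper_fin {R : realType} {n : nat} (f : 'cV[R]_n -> \bar R) x :
  proper_fun f -> edom f x -> f x = (fine (f x))%:E.
Proof.
by move=> [fN _] fx; rewrite fineK// fin_numE gt_eqF ?lt_eqF// fN.
Qed.

Section Conjugate.
Context {R : realType} {n : nat} (f : 'cV[R]_n -> \bar R).
Hypothesis f_proper : proper_fun f.

(** Bounds on a conjugate as families of real inequalities; the points where
    [f] is infinite impose nothing. *)
Lemma fconj_leP u s : (fconj f u <= s%:E)%E <->
  forall x a, (f x <= a%:E)%E -> dotv u x - a <= s.
Proof.
split=> [us x a fxa|H].
  have fx : (f x < +oo)%E by exact: le_lt_trans fxa (ltry _).
  have := le_trans (@ereal_sup_ubound _ _ _ (imageT _ x)) us.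
  rewrite (proper_fin _ _ f_proper fx) in fxa *.
  rewrite -EFinB !lee_fin in fxa *; lra.
apply: ge_ereal_sup => _ [x _ <-].
have [fx|fx] := ltP (f x) +oo%E; last first.
  by move: fx; rewrite leye_eq => /eqP ->; rewrite leNye.
have fE := proper_fin _ _ f_proper fx.
by rewrite fE -EFinB lee_fin; apply: H; rewrite -fE.
Qed.

Lemma fconj_gtNy u : (-oo < fconj f u)%E.
Proof.
have [_ [x fx]] := f_proper.
apply: lt_le_trans (@ereal_sup_ubound _ _ _ (imageT _ x)).
by rewrite (proper_fin _ _ f_proper fx) -EFinB ltNyr.
Qed.

Lemma fconj_fin u : edom (fconj f) u -> fconj f u = (fine (fconj f u))%:E.
Proof. by move=> fu; rewrite fineK// fin_numE gt_eqF ?fconj_gtNy ?lt_eqF. Qed.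

(** A conjugate is a supremum of affine functions. *)
Lemma fconj_convex : forall u v a b (t : R), 0 <= t <= 1 ->
  (fconj f u <= a%:E)%E -> (fconj f v <= b%:E)%E ->
  (fconj f (t *: u + (1 - t) *: v)%R <= (t * a + (1 - t) * b)%R%:E)%E.
Proof.
move=> u v a b t /andP[t0 t1] /fconj_leP fa /fconj_leP fb.
apply/fconj_leP => x c fx; rewrite dotvDl !dotvZl.
have := ler_wpM2l t0 (fa _ _ fx).
have : (1 - t) * (dotv v x - c) <= (1 - t) * b.
  by apply: ler_wpM2l (fb _ _ fx); rewrite subr_ge0.
lra.
Qed.

End Conjugate.

Section StrongDuality.
Context {R : realType} {m n : nat} (f : 'cV[R]_n -> \bar R)
  (g : 'cV[R]_m -> \bar R) (A : 'M[R]_(m, n)).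

(** Both forms of the qualification yield the same algebraic property of the
    domain of the perturbed value function. In the Slater form, prolonging a
    segment inside [edom f] beyond the Slater point provides the opposite
    direction, because [A] maps that point to [c]. *)
Lemma qualification_core : qualification f g A ->
  let V := [set u - A *m x | u in edom g & x in edom f] in
  V 0 /\ forall v, V v -> exists2 e : R, 0 < e & V (- (e *: v)).
Proof.
move=> qual V; case: qual => [riV|[c [gE [x0 [rix0 /= Ax0]]]]].
  split; first exact: ri_sub.
  move=> v Vv; have [e e0] := ri_prolong _ _ _ riV Vv.
  by rewrite add0r sub0r scalerN; exists e.
have gc : edom g c by rewrite /edom/= gE /delta in_set1 eqxx ltry.
split; first by exists c => //; exists x0; [exact: ri_sub|rewrite Ax0 subrr].
move=> _ [z gz [x fx <-]].
have -> : z = c.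
  by move: gz; rewrite /edom/= gE /delta in_set1; case: eqP.
have [e e0 fe] := ri_prolong _ _ _ rix0 fx; exists e => //.
exists c => //; eexists; first exact: fe.
rewrite mulmxDr -scalemxAr mulmxBr Ax0 opprD addrA subrr sub0r.
by [].
Qed.

(** The dual vector is a subgradient at [0] of the perturbed value function
    [u |-> inf_x f x + g (A *m x + u)], described by the pairs [(u, r)] with
    [r] an upper bound of the perturbed objective at some [x]; the
    qualification makes [0] an algebraic relative interior point of its
    domain. *)
Lemma strong_duality (p : R) : proper_fun f -> convex_fun f -> proper_fun g ->
  convex_fun g -> qualification f g A ->
  (forall x, p%:E <= primal_obj f g A x)%E ->
  exists y, (p%:E <= dual_obj f g A y)%E.
Proof.
move=> fp fc gp gc /qualification_core[_ core] pP.
pose K (u : 'cV[R]_m) (r : R) := exists x z a b,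
  [/\ (f x <= a%:E)%E, (g z <= b%:E)%E, u = z - A *m x & r = a + b].
have [||| y yP] := @subgradient_exists R m K p.
- move=> u r u' r' t t01 [x [z [a [b [fx gz -> ->]]]]].
  move=> [x' [z' [a' [b' [fx' gz' -> ->]]]]].
  exists (t *: x + (1 - t) *: x'), (t *: z + (1 - t) *: z').
  exists (t * a + (1 - t) * a'), (t * b + (1 - t) * b'); split.
  + exact: convex_funP.
  + exact: convex_funP.
  + rewrite mulmxDr -!scalemxAr !scalerBr opprD !addrA; congr (_ - _).
    by rewrite addrAC.
  + ring.
- move=> r [x [z [a [b [fx gz]]]]] /eqP.
  rewrite eq_sym subr_eq0 => /eqP zE ->; rewrite -lee_fin EFinD.
  apply: le_trans (pP x) _; rewrite /primal_obj -zE.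
  exact: leeD.
- move=> u _ [x [z [a [b [fx gz -> _]]]]].
  have [|e e0 [z' gz' [x' fx' zE]]] := core (z - A *m x).
    exists z; first by exact: le_lt_trans gz (ltry _).
    by exists x => //; exact: le_lt_trans fx (ltry _).
  exists e, (fine (f x') + fine (g z')); split => //.
  rewrite -zE.
  exists x', z', (fine (f x')), (fine (g z')); split => //.
  + by rewrite -proper_fin.
  + by rewrite -proper_fin.
have {}yP x z a b : (f x <= a%:E)%E -> (g z <= b%:E)%E ->
    p + (dotv y z - dotv y (A *m x)) <= a + b.
  move=> fx gz; rewrite -dotvBr; apply: yP.
  by exists x, z, a, b.
exists y.
have gy : edom (fconj g) y.
  have [_ [x fx]] := fp.
  apply: le_lt_trans (ltry (fine (f x) + dotv y (A *m x) - p)).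
  apply/(fconj_leP _ gp) => z b gz.
  have := yP x z (fine (f x)) b; rewrite -proper_fin// => /(_ (lexx _) gz).
  lra.
have gE := fconj_fin _ gp _ gy.
have fs : (fconj f (- (A^T *m y)) <= (- p - fine (fconj g y))%:E)%E.
  apply/(fconj_leP _ fp) => x a fx.
  rewrite dotvNl dotv_mulmx trmxK.
  have /(fconj_leP _ gp) : (fconj g y <= (a + dotv y (A *m x) - p)%:E)%E.
    by apply/(fconj_leP _ gp) => z b gz; have := yP x z a b fx gz; lra.
  rewrite -(fconj_leP _ gp) gE lee_fin.
  lra.
have fE : fconj f (- (A^T *m y)) = (fine (fconj f (- (A^T *m y))))%:E.
  by apply: fconj_fin => //; exact: le_lt_trans fs (ltry _).
rewrite /dual_obj fE gE -EFinN -EFinB lee_fin.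
rewrite fE lee_fin in fs; lra.
Qed.

End StrongDuality.

(** * Bregman distances *)

Section Gradient.
Context {R : realType} {n : nat} (p : 'cV[R]_n -> \bar R).

(** By linearity of the differential, the partial derivatives determine all
    directional derivatives. *)
Lemma gradE z d : differentiable_fun_at p z ->
  'D_d (fine \o p : 'cV[R]_n -> R^o) z = dotv (grad p z) d.
Proof.
move=> [_ dp]; rewrite deriveE// [in LHS](matrix_sum_delta d) linear_sum.
apply: eq_bigr => i _; rewrite big_ord1 linearZ/= mxE deriveE//.
by rewrite mulrC.
Qed.

Lemma is_derive_line z d (t : R) : differentiable_fun_at p (z + t *: d) ->
  is_derive t 1 (fun s : R => fine (p (z + s *: d)) : R^o)
    (dotv (grad p (z + t *: d)) d).
Proof.
move=> dz; have [_ dp] := dz.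
have qE : (fun h : R => h^-1 *: (((fun s : R => fine (p (z + s *: d)) : R^o)
      \o shift t) (h *: 1) - (fine (p (z + t *: d)) : R^o))) =
    (fun h : R => h^-1 *: (((fine \o p : 'cV[R]_n -> R^o)
      \o shift (z + t *: d)) (h *: d) - (fine (p (z + t *: d)) : R^o))).
  apply/funext => h /=; congr (_ *: (fine (p _) - _)).
  by rewrite [h *: 1]mulr1 scalerDl addrCA.
have dvb := diff_derivable (v := d) dp.
split.
  by rewrite /derivable qE; exact: dvb.
by rewrite -gradE// /derive qE.
Qed.

End Gradient.

(** The Bregman distance with real values; [bregman] is this one on the domain
    of the prox-function. *)
Definition rbregman {R : realType} {n : nat} (p : 'cV[R]_n -> \bar R)
  (z z0 : 'cV[R]_n) : R :=
  fine (p z) - fine (p z0) - dotv (grad p z0) (z - z0).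

Section Bregman.
Context {R : realType} {k n : nat} (S : 'M[R]_(k, n)) (p : 'cV[R]_n -> \bar R).
Hypothesis p_gtNy : forall z, (-oo < p z)%E.
Hypothesis p_sc : strongly_convex1 S p.

Lemma fineK_gtNy z : edom p z -> p z = (fine (p z))%:E.
Proof. by move=> pz; rewrite fineK// fin_numE gt_eqF ?lt_eqF. Qed.

Lemma bregmanE z z0 : edom p z -> edom p z0 ->
  bregman p z z0 = (rbregman p z z0)%:E.
Proof.
move=> pz pz0; rewrite /bregman (fineK_gtNy z)// (fineK_gtNy z0)//.
Qed.

Lemma strongly_convexP z z' (t : R) : 0 <= t <= 1 -> edom p z -> edom p z' ->
  fine (p (t *: z + (1 - t) *: z'))
    + 2^-1 * t * (1 - t) * wnorm S (z - z') ^+ 2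
  <= t * fine (p z) + (1 - t) * fine (p z').
Proof.
move=> t01 pz pz'; have := p_sc z z' t t01.
rewrite (fineK_gtNy z)// (fineK_gtNy z')// -!EFinM -EFinD.
move=> h; have pt : edom p (t *: z + (1 - t) *: z').
  apply: le_lt_trans (ltry _); apply: le_trans h.
  rewrite leeDl// lee_fin mulr_ge0 ?sqr_ge0//.
  by rewrite mulr_ge0 ?subr_ge0; lra.
by rewrite (fineK_gtNy _ pt) -EFinD lee_fin in h.
Qed.

Lemma rbregman_strongly_convex z z' z0 (t : R) :
  0 <= t <= 1 -> edom p z -> edom p z' ->
  rbregman p (t *: z + (1 - t) *: z') z0
    + 2^-1 * t * (1 - t) * wnorm S (z - z') ^+ 2
  <= t * rbregman p z z0 + (1 - t) * rbregman p z' z0.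
Proof.
move=> t01 pz pz'; have := strongly_convexP _ _ _ t01 pz pz'.
by rewrite /rbregman !dotvBr !dotvDr !dotvZr; lra.
Qed.

(** Divide the strong convexity inequality on the segment from [z0] to [z] by
    the parameter [t] and let [t] tend to [0]. *)
Lemma rbregman_ge z z0 : edom p z -> differentiable_fun_at p z0 ->
  2^-1 * wnorm S (z - z0) ^+ 2 <= rbregman p z z0.
Proof.
move=> pz dz0.
have pz0 : edom p z0 by have [/interior_subset] := dz0.
set d := z - z0; set N := wnorm S d ^+ 2.
pose phi (s : R) : R^o := fine (p (z0 + s *: d)).
have dphi : is_derive (0 : R) 1 phi (dotv (grad p z0) d).
  have := is_derive_line p z0 d 0; rewrite scale0r addr0; exact.
pose q (h : R) : R^o := h^-1 *: ((phi \o shift 0) (h *: 1) - phi 0).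
have qcvg : q h @[h --> 0^'+] --> dotv (grad p z0) d.
  by apply: cvg_dnbhs_at_right; rewrite -(@derive_val _ _ _ _ _ _ _ dphi);
    apply: (@ex_derive _ _ _ _ _ _ _ dphi).
have ncvg : (2^-1 * (1 - h) * N) @[h --> (0 : R)^'+] --> 2^-1 * (1 - 0) * N.
  apply: cvg_at_right_filter; apply: cvgM; last exact: cvg_cst.
  apply: cvgM; first exact: cvg_cst.
  by apply: cvgB; [exact: cvg_cst|exact: cvg_id].
rewrite subr0 mulr1 in ncvg.
have cvgs : (q h + 2^-1 * (1 - h) * N) @[h --> (0 : R)^'+] -->
    dotv (grad p z0) d + 2^-1 * N by exact: cvgD.
have le_near : \forall h \near (0 : R)^'+,
    q h + 2^-1 * (1 - h) * N <= fine (p z) - fine (p z0).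
  near=> h.
  have h0 : 0 < h by near: h; exact: nbhs_right_gt.
  have h1 : h < 1 by near: h; exact: nbhs_right_lt.
  have h01 : 0 <= h <= 1 by rewrite !ltW.
  have := strongly_convexP _ _ _ h01 pz pz0.
  rewrite -/d -/N /q /phi /= addr0 scale0r addr0 [h *: 1]mulr1.
  have -> : h *: z + (1 - h) *: z0 = z0 + h *: d.
    by rewrite /d scalerBl scale1r scalerBr addrCA.
  set a := fine (p (_ + _)); move=> ha.
  rewrite -(ler_pM2l h0) mulrDr [_ *: _]/(_ * _) mulrA mulfV ?gt_eqF// mul1r.
  by lra.
have lim_le : lim ((q h + 2^-1 * (1 - h) * N) @[h --> (0 : R)^'+])
    <= fine (p z) - fine (p z0).
  by apply: limr_le; [exact: (cvgP _ cvgs)|exact: le_near].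
move: lim_le; rewrite (cvg_lim _ cvgs)// /rbregman -/d.
by lra.
Unshelve. all: by end_near. Qed.

(** The descent lemma. Along the line through [z0] and [z], subtract from [p]
    its linearization and the quadratic bound: the derivative of the result at
    [c >= 0] is at most [L * c * N ^+ 2 - L * N ^+ 2 * c = 0], and the mean
    value theorem concludes. *)
Lemma rbregman_le (Z : set 'cV[R]_n) (L : R) z z0 :
  posdefmx (S^T *m S) ->
  (forall t : R, Z (z0 + t *: (z - z0))) ->
  (forall y, Z y -> differentiable_fun_at p y) ->
  (forall y y', Z y -> Z y' ->
     dual_wnorm S (grad p y - grad p y') <= L * wnorm S (y - y')) ->
  rbregman p z z0 <= 2^-1 * L * wnorm S (z - z0) ^+ 2.
Proof.
move=> SP segZ dZ lipZ; set d := z - z0; set N := wnorm S d.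
pose df (s : R) : R^o := dotv (grad p (z0 + s *: d)) d
  - dotv (grad p z0) d - L * N ^+ 2 * s.
pose phi (s : R) : R^o := fine (p (z0 + s *: d)) - dotv (grad p z0) d * s
  - 2^-1 * L * N ^+ 2 * s ^+ 2.
have dphi (s : R) : is_derive s 1 phi (df s).
  have ds := is_derive_line p z0 d s (dZ _ (segZ s)).
  apply: is_derive_eq; rewrite /df /GRing.scale/= /GRing.scale/=. by field.
have cphi : {within `[0, 1], continuous phi}.
  apply: derivable_within_continuous => s _.
  exact: (@ex_derive _ _ _ _ _ _ _ (dphi s)).
have [c cI cE] := MVT ltr01 (fun s _ => dphi s) cphi.
move: cI; rewrite in_itv/= => /andP[c0 c1].
have : df c <= 0.
  rewrite /df -dotvBl subr_le0; apply: le_trans (dotv_le_dual _ SP _ _) _.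
  rewrite -/N; have := lipZ _ _ (segZ c) (segZ 0).
  rewrite -/d scale0r !addr0 (addrC z0) addrK wnormZ gtr0_norm// -/N => h.
  apply: le_trans (ler_wpM2r (wnorm_ge0 _ _) h) _.
  by rewrite -/N le_eqVlt; apply/orP; left; apply/eqP; ring.
move=> dfc; move: cE; rewrite /phi /rbregman scale1r scale0r addr0 (addrC z0) subrK -/d expr0n /= expr1n mulr0 !mulr1 !mulr0 !subr0.
lra.
Qed.

End Bregman.

(** * Maximizers of strongly concave functions *)

Lemma dotv_continuous {R : realType} {n : nat} (u : 'cV[R]_n) :
  continuous (dotv u : 'cV[R]_n -> R^o).
Proof.
move=> x.
have -> : (dotv u : 'cV[R]_n -> R^o) =
    \sum_(i < n) (fun v : 'cV[R]_n => u i 0 * v i 0 : R^o).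
  by apply/funext => v; rewrite fct_sumE.
apply: (big_ind (fun g : 'cV[R]_n -> R^o => {for x, continuous g})).
- exact: (@cst_continuous _ _ (0 : R^o) x).
- by move=> g g'; exact: continuousD.
- move=> i _; apply: continuousM; [exact: cst_continuous|exact: coord_continuous].
Qed.

Lemma fconj_closed {R : realType} {n : nat} (f : 'cV[R]_n -> \bar R) :
  proper_fun f -> closed_fun (fconj f).
Proof.
move=> fp; rewrite /closed_fun.
have -> : epigraph (fconj f) =
  \bigcap_(xa in [set xa : 'cV[R]_n * R | (f xa.1 <= xa.2%:E)%E])
    [set z : 'cV[R]_n * R^o | dotv xa.1 z.1 - xa.2 <= z.2].
  apply/seteqP; split=> [z /(fconj_leP _ fp) fz [x a] /= fx|z fz].
    by rewrite dotvC; exact: fz.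
  apply/(fconj_leP _ fp) => x a fx; rewrite dotvC.
  exact: (fz (x, a)).
apply: closed_bigI => -[x a] _ /=.
pose G (z : 'cV[R]_n * R^o) : R^o := z.2 - (dotv x z.1 - a).
have -> : [set z : 'cV[R]_n * R^o | dotv x z.1 - a <= z.2] =
    G @^-1` [set r : R^o | 0 <= r].
  by apply/seteqP; split=> z /=; rewrite subr_ge0.
have Gc : continuous G.
  move=> z; apply: cvgB; first exact: cvg_snd.
  apply: cvgB; last exact: cvg_cst.
  by apply: continuous_comp; [exact: cvg_fst|exact: dotv_continuous].
by apply: (continuous_closedP _).1 Gc [set r : R^o | 0 <= r] _; exact: closed_ge.
Qed.

(** Strong concavity bounds the distance between two nearly optimal points
    through the value at their midpoint. Hence a maximizing sequence is Cauchy;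
    its limit is optimal because the epigraph of [h] is closed and [q] is
    continuous. The maximal value of [q - h] is [s], attained at [y]. *)
Lemma strongly_concave_argmax {R : realType} {k n : nat} (S : 'M[R]_(k, n))
  (h : 'cV[R]_n -> \bar R) (q : 'cV[R]_n -> R) (mu M : R) y0 a0 :
  posdefmx (S^T *m S) -> 0 < mu ->
  (forall y z a b (t : R), 0 <= t <= 1 -> (h y <= a%:E)%E -> (h z <= b%:E)%E ->
     (h (t *: y + (1 - t) *: z)%R <= (t * a + (1 - t) * b)%R%:E)%E) ->
  closed_fun h ->
  (forall y, closure (edom h) y -> {for y, continuous (q : 'cV[R]_n -> R^o)}) ->
  (forall y z (t : R), 0 <= t <= 1 -> edom h y -> edom h z ->
     t * q y + (1 - t) * q z + mu * t * (1 - t) * wnorm S (y - z) ^+ 2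
     <= q (t *: y + (1 - t) *: z)) ->
  (forall y a, (h y <= a%:E)%E -> q y - a <= M) ->
  (h y0 <= a0%:E)%E ->
  exists y s, (h y <= (q y - s)%:E)%E /\
    forall z a, (h z <= a%:E)%E -> q z - a <= s.
Proof.
move=> SP mu0 hconv hcl qc qsc qM h0.
pose V := [set v | exists y a, (h y <= a%:E)%E /\ v = q y - a].
have Vub : has_ubound V by exists M => _ [y [a [hy ->]]]; exact: qM.
have V0 : V !=set0 by exists (q y0 - a0), y0, a0.
pose s := sup V.
have sP z a : (h z <= a%:E)%E -> q z - a <= s.
  by move=> hz; apply: ub_le_sup => //; exists z, a.
have app (i : nat) : exists ya : 'cV[R]_n * R, (h ya.1 <= ya.2%:E)%E /\
    s - i.+1%:R^-1 < q ya.1 - ya.2.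
  have i0 : 0 < (i.+1%:R^-1 : R) by rewrite invr_gt0 ltr0n.
  have [_ [y [a [hy ->]]] lt_s] := sup_adherent i0 (conj V0 Vub).
  by exists (y, a).
have [ya yaP] := choice app.
pose y_ i := (ya i).1; pose a_ i := (ya i).2.
have edom_y i : edom h (y_ i).
  by apply: le_lt_trans (ltry (a_ i)); have [] := yaP i.
have dist i j : (i <= j)%N ->
    mu * wnorm S (y_ i - y_ j) ^+ 2 <= 4 * i.+1%:R^-1.
  move=> ij; have t01 : 0 <= (2^-1 : R) <= 1 by lra.
  have [hi si] := yaP i; have [hj sj] := yaP j.
  have := sP _ _ (hconv _ _ _ _ _ t01 hi hj).
  have := qsc _ _ _ t01 (edom_y i) (edom_y j).
  have : (j.+1%:R^-1 : R) <= i.+1%:R^-1.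
    by rewrite lef_pV2 ?posrE ?ltr0n// ler_nat.
  rewrite -/(y_ i) -/(y_ j) -/(a_ i) -/(a_ j) in si sj *.
  set Q := q (_ + _); set d := wnorm S _ ^+ 2.
  set ii := i.+1%:R^-1 in si *; set jj := j.+1%:R^-1 in sj *.
  lra.
have [C C0 CP] := norm_le_wnorm S SP.
have ycvg : cvg (y_ i @[i --> \oo]).
  apply: cauchy_cvg; apply: cauchy_exP => e /= e0.
  pose d := mu * (e / C) ^+ 2 / 4.
  have d0 : 0 < d.
    by apply: divr_gt0 => //; rewrite mulr_gt0// exprn_gt0// divr_gt0.
  have [N _ NP] : \forall i \near \oo, (i.+1%:R^-1 : R) < d.
    exact: near_infty_natSinv_lt (PosNum d0).
  exists (y_ N); exists N => // j /= Nj.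
  rewrite -ball_normE /ball_ /=.
  suff dlt : wnorm S (y_ N - y_ j) < e / C.
    by apply: le_lt_trans (CP _) _; rewrite mulrC -ltr_pdivlMr.
  rewrite -(ltr_pXn2r (n := 2)) ?nnegrE ?wnorm_ge0 ?divr_ge0 ?ltW//.
  rewrite -(ltr_pM2l mu0); apply: le_lt_trans (dist _ _ Nj) _.
  by have := NP N (leqnn N); rewrite /= /d ltr_pdivlMr// mulrC.
have /cvg_ex[/= y ylim] := ycvg; exists y, s; split => //.
have cly : closure (edom h) y.
  apply: (closed_cvg (closure (edom h))) ylim; first exact: closed_closure.
  by near=> i; apply: subset_closure; exact: edom_y.
(* The heights a_ need not converge; r_ dominates them and does. *)
pose r_ i := q (y_ i) - s + i.+1%:R^-1.
have rlim : (r_ i : R^o) @[i --> \oo] --> (q y - s : R^o).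
  rewrite -[X in _ --> X]addr0; apply: cvgD; last exact: cvg_harmonic.
  apply: cvgB; last exact: cvg_cst.
  exact: (cvg_comp _ _ ylim (qc _ cly)).
have : epigraph h (y, q y - s).
  apply: (closed_cvg (epigraph h) hcl _ (y, q y - s)
    (u_ := fun i => (y_ i, r_ i)) (F := \oo)).
    near=> i; rewrite /epigraph/=; have [hi si] := yaP i.
    apply: le_trans hi _; rewrite lee_fin /r_ /y_; rewrite -/(y_ i) -/(a_ i) in si *; set Q := q _ in si *; set ii := _.+1%:R^-1 in si *. lra.
  exact: (cvg_pair ylim rlim).
by [].
Unshelve. all: by end_near. Qed.

(** * The smoothed conjugate *)

Lemma le_of_shrink {R : realType} (x y : R) :
  (forall t, 0 < t < 1 -> (1 - t) * x <= y) -> x <= y.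
Proof.
move=> H; have half : 0 < (2^-1 : R) < 1 by lra.
have hx := H _ half; rewrite leNgt; apply/negP => yx.
have x0 : 0 < x by lra.
(* For this t, (1 - t) * x is the midpoint of x and y. *)
have := H ((x - y) / (2 * x)); rewrite divr_gt0 ?ltr_pdivrMr; try lra.
have -> : (1 - (x - y) / (2 * x)) * x = (x + y) / 2.
  by field; rewrite gt_eqF.
rewrite (_ : x - y < 1 * (2 * x)); last by lra.
move=> /(_ isT); lra.
Qed.

Section SmoothedConjugate.
Context {R : realType} {k m : nat} (S : 'M[R]_(k, m))
  (g p : 'cV[R]_m -> \bar R) (L beta : R) (u ydot : 'cV[R]_m).
Hypotheses (g_proper : proper_fun g) (SP : posdefmx (S^T *m S))
  (p_prox : prox_function S (closure (edom (fconj g))) L p)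
  (beta_gt0 : 0 < beta) (ydotP : closure (edom (fconj g)) ydot).

Let q y := dotv u y - beta * rbregman p y ydot.

Lemma smooth_g_objE y : closure (edom (fconj g)) y ->
  smooth_g_obj g p beta u ydot y = ((q y)%:E - fconj g y)%E.
Proof.
case: p_prox => pN [Yp _] _ _ _ Yy; rewrite /smooth_g_obj.
rewrite bregmanE//; [|exact: Yp|exact: Yp].
case: (fconj g y) (fconj_gtNy _ g_proper y) => [r _||]//.
by rewrite -EFinM -!EFinB; congr EFin; rewrite /q; ring.
Qed.

Lemma smooth_g_ge y b : (fconj g y <= b%:E)%E ->
  ((q y - b)%:E <= smooth_g g p beta u ydot)%E.
Proof.
move=> gy.
have Yy : closure (edom (fconj g)) y.
  by apply: subset_closure; exact: le_lt_trans gy (ltry _).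
apply: le_trans (ereal_sup_ubound _); last by exists y.
by rewrite smooth_g_objE// EFinB leeB.
Qed.

Lemma smoothing_concave y z (t : R) : 0 <= t <= 1 ->
  edom (fconj g) y -> edom (fconj g) z ->
  t * q y + (1 - t) * q z + beta / 2 * t * (1 - t) * wnorm S (y - z) ^+ 2
  <= q (t *: y + (1 - t) *: z).
Proof.
case: p_prox => pN [Yp _] psc _ _ t01 gy gz.
have py : edom p y by apply: Yp; exact: subset_closure.
have pz : edom p z by apply: Yp; exact: subset_closure.
have := rbregman_strongly_convex S p pN psc y z ydot t t01 py pz.
rewrite /q dotvDr !dotvZr -(ler_pM2l beta_gt0).
set P := rbregman _ _ _; set B1 := rbregman p y _; set B2 := rbregman p z _.
set N := _ ^+ 2; lra.
Qed.

Lemma smoothing_continuous y : closure (edom (fconj g)) y ->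
  {for y, continuous (q : 'cV[R]_m -> R^o)}.
Proof.
case: p_prox => pN [Yp _] psc pd _ Yy.
have [_ dp] := pd _ Yy.
have pc := differentiable_continuous dp.
have FF : Filter (nbhs y) := nbhs_filter y.
rewrite /continuous_at; apply: (@cvgB _ _ _ _ FF); first exact: dotv_continuous.
apply: cvgM; first exact: cvg_cst.
apply: cvgB; first by apply: cvgB; [exact: pc|exact: cvg_cst].
have -> : (fun z => dotv (grad p ydot) (z - ydot) : R^o) =
    (fun z => dotv (grad p ydot) z - dotv (grad p ydot) ydot : R^o).
  by apply/funext => z; rewrite dotvBr.
by rewrite dotvBr; apply: cvgB; [exact: dotv_continuous|exact: cvg_cst].
Qed.

(** Each point of [edom g] provides an affine minorant of [fconj g], while the
    Bregman distance grows at least quadratically; the bound completes the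
    square. *)
Lemma smoothing_bounded : exists M, forall y a, (fconj g y <= a%:E)%E ->
  q y - a <= M.
Proof.
case: p_prox => pN [Yp _] psc pd _.
have [_ [z gz]] := g_proper.
set c := dual_wnorm S (u - z).
exists (dotv (u - z) ydot + fine (g z) + c ^+ 2 / (2 * beta)) => y a gy.
have Yy : closure (edom (fconj g)) y.
  by apply: subset_closure; exact: le_lt_trans gy (ltry _).
have /(fconj_leP _ g_proper) /(_ z (fine (g z))) := gy.
rewrite -proper_fin// => /(_ (lexx _)) gya.
have := rbregman_ge S p pN psc y ydot (Yp _ Yy) (pd _ ydotP).
rewrite -(ler_pM2l beta_gt0) => breg.
have := dotv_le_dual S SP (u - z) (y - ydot); rewrite -/c.
set N := wnorm S _ in breg * => lin.
have sq : 0 <= (c - beta * N) ^+ 2 / (2 * beta).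
  by rewrite divr_ge0 ?sqr_ge0// mulr_ge0// ltW.
have sqE : (c - beta * N) ^+ 2 / (2 * beta) =
    c ^+ 2 / (2 * beta) - c * N + beta * (2^-1 * N ^+ 2).
  by field; rewrite gt_eqF.
rewrite sqE in sq.
rewrite dotvC in gya.
move: lin; rewrite dotvBr !dotvBl /q.
lra.
Qed.

(** The set of maximizers is nonempty, so that [get] selects one of them. *)
Lemma smooth_g_argmaxP : let yb := smooth_g_argmax g p beta u ydot in
  closure (edom (fconj g)) yb /\ forall y, closure (edom (fconj g)) y ->
  (smooth_g_obj g p beta u ydot y <= smooth_g_obj g p beta u ydot yb)%E.
Proof.
have [M qM] := smoothing_bounded.
have [y0 gy0] : edom (fconj g) !=set0.
  apply/set0P/negP => /eqP e0; move: ydotP; rewrite e0 closure0; exact.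
have [y [s [gy ys]]] : exists y s, (fconj g y <= (q y - s)%:E)%E /\
    forall z a, (fconj g z <= a%:E)%E -> q z - a <= s.
  apply: (strongly_concave_argmax S (fconj g) q (beta / 2) M y0
    (fine (fconj g y0))) => //.
  - by rewrite divr_gt0.
  - exact: fconj_convex.
  - exact: fconj_closed.
  - exact: smoothing_continuous.
  - exact: smoothing_concave.
  - by rewrite -fconj_fin.
have gyfin : edom (fconj g) y by exact: le_lt_trans gy (ltry _).
apply: (@getPex _ [set y | closure (edom (fconj g)) y /\
    forall y', closure (edom (fconj g)) y' ->
      (smooth_g_obj g p beta u ydot y' <= smooth_g_obj g p beta u ydot y)%E]).
exists y; split=> [|z Yz]; first exact: subset_closure.
rewrite !smooth_g_objE//; last exact: subset_closure.
have [gz|] := ltP (fconj g z) +oo%E; last first.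
  by rewrite leye_eq => /eqP ->; rewrite addeNy leNye.
have := ys z (fine (fconj g z)); rewrite -fconj_fin// => /(_ (lexx _)) zs.
rewrite (fconj_fin _ g_proper _ gyfin) lee_fin in gy.
rewrite (fconj_fin _ g_proper _ gz) (fconj_fin _ g_proper _ gyfin).
by rewrite -!EFinB lee_fin; lra.
Qed.

(** At the maximizer of a strongly concave function, the value exceeds that at
    any other point by a quadratic term: compare with the points of the segment
    and let them tend to the maximizer. *)
Lemma smooth_g_growth y b : (fconj g y <= b%:E)%E ->
  ((q y - b
    + beta * (2^-1 * wnorm S (smooth_g_argmax g p beta u ydot - y) ^+ 2))%:E
   <= smooth_g g p beta u ydot)%E.
Proof.
move=> gyb; have [] := smooth_g_argmaxP.
set yb := smooth_g_argmax _ _ _ _ _ => Yyb ybmax.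
have gy : edom (fconj g) y by exact: le_lt_trans gyb (ltry _).
have Yy := subset_closure gy.
have gyb' : edom (fconj g) yb.
  have := ybmax _ Yy; rewrite !smooth_g_objE// (fconj_fin _ g_proper _ gy).
  rewrite /edom/= -EFinB; by case: (fconj g yb) => [r _||]//=; exact: ltry.
have bb := fconj_fin _ g_proper _ gyb'.
set c := fine _ in bb.
have cE : (fconj g yb <= c%:E)%E by rewrite bb.
apply: le_trans (smooth_g_ge _ _ cE); rewrite lee_fin.
set N := wnorm S _ ^+ 2.
have seg (t : R) : 0 < t < 1 -> q y - b + beta / 2 * (1 - t) * N <= q yb - c.
  move=> /andP[t0 t1].
  have t01 : 0 <= 1 - t <= 1 by lra.
  have gt := fconj_convex g g_proper yb y c b _ t01 cE gyb.
  have gtfin : edom (fconj g) ((1 - t) *: yb + (1 - (1 - t)) *: y).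
    exact: le_lt_trans gt (ltry _).
  have := ybmax _ (subset_closure gtfin).
  rewrite !smooth_g_objE//; last exact: subset_closure.
  rewrite bb (fconj_fin _ g_proper _ gtfin) -!EFinB lee_fin.
  rewrite (fconj_fin _ g_proper _ gtfin) lee_fin in gt.
  have := smoothing_concave yb y (1 - t) t01 gyb' gy; rewrite -/N => h1 h2.
  rewrite -(ler_pM2l t0); lra.
rewrite -lerBrDl; apply: le_of_shrink => t t01.
by have := seg t t01; lra.
Qed.

End SmoothedConjugate.

(** * Primal and dual solutions *)

Section PrimalDual.
Context {R : realType} {m n : nat} (f : 'cV[R]_n -> \bar R)
  (g : 'cV[R]_m -> \bar R) (A : 'M[R]_(m, n)).
Hypotheses (f_proper : proper_fun f) (g_proper : proper_fun g).

(** The qualification provides a feasible point, so that the optimal value is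
    finite. *)
Lemma primal_sol_fin xs : qualification f g A -> primal_sol f g A xs ->
  [/\ f xs = (fine (f xs))%:E, g (A *m xs) = (fine (g (A *m xs)))%:E
    & primal_val f g A = (fine (f xs) + fine (g (A *m xs)))%:E].
Proof.
move=> /qualification_core[[z gz [x fx]] /eqP]; rewrite subr_eq0 => /eqP zE _.
move=> xsP.
have lt_y : (primal_obj f g A xs < +oo)%E.
  apply: le_lt_trans (xsP x) _; rewrite /primal_obj -zE.
  by rewrite (proper_fin _ _ f_proper fx) (proper_fin _ _ g_proper gz) ltry.
have fxs : edom f xs.
  move: lt_y; rewrite /primal_obj /edom/= !ltey; apply: contra_neq => ->.
  by rewrite addye// gt_eqF//; case: g_proper => + _; exact.
have gxs : edom g (A *m xs).
  move: lt_y; rewrite /primal_obj /edom/= !ltey; apply: contra_neq => ->.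
  by rewrite addey// gt_eqF//; case: f_proper => + _; exact.
have fE := proper_fin _ _ f_proper fxs; have gE := proper_fin _ _ g_proper gxs.
split => //; rewrite EFinD -fE -gE; apply/eqP; rewrite eq_le; apply/andP; split.
  by apply: ereal_inf_lbound; exists xs.
by apply: le_ereal_inf_tmp => _ [x' _ <-]; exact: xsP.
Qed.

(** By strong duality a dual solution is a Lagrange multiplier: it bounds the
    primal objective from below at every point. *)
Lemma dual_sol_multiplier ys (p : R) : convex_fun f -> convex_fun g ->
  qualification f g A -> primal_val f g A = p%:E -> dual_sol f g A ys ->
  exists2 b : R, fconj g ys = b%:E & forall x a, (f x <= a%:E)%E ->
    p + b <= a + dotv ys (A *m x).
Proof.
move=> fc gc qual pE ysP.
have pP x : (p%:E <= primal_obj f g A x)%E.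
  by rewrite -pE; apply: ereal_inf_lbound; exists x.
have [y yP] := strong_duality f g A p f_proper fc g_proper gc qual pP.
have := le_trans yP (ysP y); rewrite /dual_obj.
have := fconj_leP _ f_proper (- (A^T *m ys)).
case: (fconj f _) (fconj_gtNy _ f_proper (- (A^T *m ys))) => [a _||]//.
case: (fconj g ys) (fconj_gtNy _ g_proper ys) => [b _||]//.
rewrite -EFinN -EFinB lee_fin => fa ab; exists b => // x r fx.
have := (fa a).1 (lexx _) _ _ fx; rewrite dotvNl dotv_mulmx trmxK; lra.
Qed.

End PrimalDual.

(** Where [f x] is infinite the residual is [+oo], and every [c] is a lower
    bound. *)
Lemma smooth_resid_ge {R : realType} {m n : nat} (f : 'cV[R]_n -> \bar R)
  (g : 'cV[R]_m -> \bar R) (A : 'M[R]_(m, n)) pY beta x ydot (p v c : R) :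
  proper_fun f ->
  primal_val f g A = p%:E -> (v%:E <= smooth_g g pY beta (A *m x) ydot)%E ->
  (forall a, f x = a%:E -> c <= a + v - p) ->
  (c%:E <= smooth_resid f g A pY beta x ydot)%E.
Proof.
move=> [fN _] pE vle ca; rewrite /smooth_resid /smooth_primal pE.
case: (f x) (fN x) ca => [a _ ca||]//.
  have := ca _ erefl; rewrite -lee_fin => /le_trans; apply.
  by rewrite EFinB EFinD leeB// leeD.
move=> _ _.
by case: (smooth_g _ _ _ _ _) vle => [r|//|//] _; rewrite ?addye ?leey.
Qed.

(** * Equality constraints *)

Section EqualityConstraint.
Context {R : realType} {m : nat} (c : 'cV[R]_m).

Lemma fconj_delta1 y : fconj (delta [set c]) y = (dotv y c)%:E.
Proof.
apply/eqP; rewrite eq_le; apply/andP; split.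
  apply: ge_ereal_sup => _ [x _ <-]; rewrite /delta in_set1.
  by case: eqP => [->|_]; rewrite ?sube0// leNye.
apply: ereal_sup_ubound; exists c => //.
by rewrite /delta in_set1 eqxx sube0.
Qed.

Lemma edom_fconj_delta1 : edom (fconj (delta [set c])) = setT.
Proof. by apply/seteqP; split=> // y _; rewrite /edom/= fconj_delta1 ltry. Qed.

Lemma primal_val_delta1 {n : nat} (f : 'cV[R]_n -> \bar R) (A : 'M[R]_(m, n)) :
  proper_fun f -> primal_val f (delta [set c]) A =
  ereal_inf [set f x | x in [set x | A *m x = c]].
Proof.
move=> [fN _]; apply/eqP; rewrite eq_le; apply/andP; split.
  apply: le_ereal_inf_tmp => _ [x /= Ax <-]; apply: ereal_inf_lbound.
  by exists x => //; rewrite /primal_obj Ax /delta in_set1 eqxx adde0.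
apply: le_ereal_inf_tmp => _ [x _ <-]; rewrite /primal_obj /delta in_set1.
case: eqP => [Ax|_]; first by rewrite adde0; apply: ereal_inf_lbound; exists x.
by rewrite addey ?leey// gt_eqF.
Qed.

End EqualityConstraint.

(** * The smoothed gap and feasibility estimates *)

(** For real [D] the claim is a rearrangement. Among infinite values only
    [D = +oo] could spoil it, by making the right-hand side [-oo]; the bound on
    [D] excludes that case. *)
Lemma lee_gap {R : realType} (T D : \bar R) (p e : R) :
  (D <= (p + e)%:E)%E -> (T - p%:E <= T - D + e%:E)%E.
Proof.
case: D => [d||]//; case: T => [t||]//=.
- by rewrite -!EFinB -EFinD !lee_fin; lra.
- by move=> _; rewrite addey// addye// leey.
Qed.

(** Complete the square in the quadratic inequality
    [rho ^+ 2 - 2 * c * a * rho <= 2 * c * s]. *)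
Lemma quadratic_bound {R : realType} (c a rho s : R) : 0 < c -> 0 <= rho ->
  rho ^+ 2 / (2 * c) - rho * a <= s ->
  0 <= a ^+ 2 + 2 / c * s /\ rho <= c * (a + Num.sqrt (a ^+ 2 + 2 / c * s)).
Proof.
move=> c0 rho0 h.
have sq : (rho / c - a) ^+ 2 <= a ^+ 2 + 2 / c * s.
  have -> : (rho / c - a) ^+ 2 =
      a ^+ 2 + 2 / c * (rho ^+ 2 / (2 * c) - rho * a).
    by field; rewrite gt_eqF.
  by rewrite lerD2l ler_wpM2l// divr_ge0// ltW.
split; first exact: le_trans (sqr_ge0 _) sq.
rewrite mulrC -ler_pdivrMr// -lerBlDl.
apply: le_trans (ler_norm _) _.
by rewrite -sqrtr_sqr ler_wsqrtr.
Qed.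

Theorem lemma2p1 (R : realType) (m n kX kY : nat)
  (f : 'cV[R]_n -> \bar R) (g : 'cV[R]_m -> \bar R) (A : 'M[R]_(m, n))
  (SX : 'M[R]_(kX, n)) (SY : 'M[R]_(kY, m))
  (pX : 'cV[R]_n -> \bar R) (pY : 'cV[R]_m -> \bar R) (LX LY : R)
  (f_proper : proper_fun f) (f_closed : closed_fun f) (f_convex : convex_fun f)
  (g_proper : proper_fun g) (g_closed : closed_fun g) (g_convex : convex_fun g)
  (primal_solvable : primal_sol f g A !=set0)
  (qual : qualification f g A)
  (SX_posdef : posdefmx (SX^T *m SX)) (SY_posdef : posdefmx (SY^T *m SY))
  (pX_prox : prox_function SX (closure (edom f)) LX pX)
  (LY_ge1 : 1 <= LY)
  (pY_prox : prox_function SY (closure (edom (fconj g))) LY pY) :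
  (forall (gamma beta : R) (xdot x : 'cV[R]_n) (ydot y : 'cV[R]_m),
     0 < gamma -> 0 < beta ->
     closure (edom f) xdot -> closure (edom (fconj g)) ydot ->
     closure (edom f) x -> closure (edom (fconj g)) y ->
     (forall xstar, primal_sol f g A xstar ->
        (smooth_resid f g A pY beta x ydot
         <= smooth_gap f g A pX pY gamma beta (x, y) (xdot, ydot)
            + gamma%:E * bregman pX xstar xdot)%E) /\
     (forall ystar, dual_sol f g A ystar ->
        ((2^-1 * wnorm SY (smooth_g_argmax g pY beta (A *m x) ydot - ystar)
                 ^+ 2)%:E
         <= bregman pY ystar ydot
            + (beta^-1)%:E * smooth_resid f g A pY beta x ydot)%E)) /\
  (forall c : 'cV[R]_m, g = delta [set c] ->
     let fstar := ereal_inf [set f x | x in [set x | A *m x = c]] in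
     forall (ystar : 'cV[R]_m) (x : 'cV[R]_n),
     dual_sol f g A ystar -> closure (edom f) x ->
     ((- (wnorm SY ystar * dual_wnorm SY (A *m x - c)))%:E <= f x - fstar)%E /\
     (forall (beta : R) (ydot : 'cV[R]_m),
        0 < beta -> closure (edom (fconj g)) ydot ->
        let S := smooth_resid f g A pY beta x ydot in
        let rad := ((wnorm SY (ystar - ydot) ^+ 2)%:E
                    + (2 * LY^-1 * beta^-1)%:E * S)%E in
        [/\ (f x - fstar <= S - (dotv ystar (A *m x - c))%:E
                            + beta%:E * bregman pY ystar ydot)%E,
            (0 <= rad)%E &
            ((dual_wnorm SY (A *m x - c))%:E
             <= (beta * LY)%:E
                * ((wnorm SY (ystar - ydot))%:E + sqrte rad))%E])).
Proof.
have [xs0 xs0P] := primal_solvable.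
have [_ _] := primal_sol_fin f g A f_proper g_proper xs0 qual xs0P.
set p := _ + _ => pE.
have mult ys := dual_sol_multiplier f g A f_proper g_proper ys p
  f_convex g_convex qual pE.
have [pXN [pXdom _] _ _ _] := pX_prox.
have [pYN [pYdom _] pYsc pYdiff pYlip] := pY_prox.
split=> [gamma beta xdot x ydot y gamma0 beta0 Xxdot Yydot Xx Yy|c gE fstar
  ys x ysP Xx].
  split=> [xs xsP|ys ysP].
    have [fE gAE] := primal_sol_fin f g A f_proper g_proper xs qual xsP.
    rewrite pE => -[pE'].
    have Xxs : closure (edom f) xs.
      by apply: subset_closure; rewrite /edom/= fE ltry.
    rewrite bregmanE; [|exact: pXN|exact: pXdom|exact: pXdom].
    rewrite /smooth_resid /smooth_gap pE /=.
    set b := rbregman _ _ _.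
    have gyge : ((dotv y (A *m xs) - fine (g (A *m xs)))%:E <= fconj g y)%E.
      by rewrite EFinB -gAE; apply: ereal_sup_ubound; exists (A *m xs).
    have Dle : (smooth_dual f g A pX gamma y xdot <= (p + gamma * b)%:E)%E.
      have -> : p + gamma * b = fine (f xs) + dotv y (A *m xs) + gamma * b
          - (dotv y (A *m xs) - fine (g (A *m xs))) by rewrite pE'; lra.
      rewrite EFinB; apply: leeB => //; apply: ereal_inf_lbound.
      exists xs => //.
      by rewrite bregmanE; [rewrite fE|exact: pXN|exact: pXdom|exact: pXdom].
    exact: lee_gap.
  have [b gys lagr] := mult ys ysP.
  rewrite bregmanE; [|exact: pYN| |exact: pYdom]; last first.
    by apply: pYdom; apply: subset_closure; rewrite /edom/= gys ltry.
  have gysle : (fconj g ys <= b%:E)%E by rewrite gys.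
  have := smooth_g_growth SY g pY LY beta (A *m x) ydot g_proper SY_posdef
    pY_prox beta0 Yydot ys b gysle.
  set B := rbregman _ _ _; set N := wnorm _ _ ^+ 2 => vle.
  have Sge : ((beta * (2^-1 * N - B))%:E <=
      smooth_resid f g A pY beta x ydot)%E.
    apply: (smooth_resid_ge f g A pY beta x ydot p _ _ f_proper pE vle) => a fx.
    have := lagr x a; rewrite fx lexx => /(_ isT).
    by rewrite (dotvC (A *m x)); lra.
  case: (smooth_resid _ _ _ _ _ _ _) Sge => [r||]//.
    rewrite -EFinM -EFinD !lee_fin mulrC -ler_pdivlMr// (mulrC r).
    lra.
  by rewrite gt0_muley ?lte_fin ?invr_gt0// addey ?leey.
have [b gys lagr] := mult ys ysP.
have Y_full : closure (edom (fconj g)) = setT.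
  by rewrite gE edom_fconj_delta1 closureT.
have bE : b = dotv ys c by move: gys; rewrite gE fconj_delta1 => -[].
have fsE : fstar = p%:E by rewrite -pE gE primal_val_delta1.
set r := A *m x - c; set rho := dual_wnorm SY r.
have lagrx a : f x = a%:E -> p - dotv ys r <= a.
  move=> fx; have := lagr x a; rewrite fx lexx => /(_ isT).
  by rewrite bE /r dotvBr; lra.
have fxN : (-oo < f x)%E by case: f_proper.
rewrite fsE; split.
  case: (f x) fxN lagrx => [a _ /(_ _ erefl) ha||]//; last by rewrite leey.
  rewrite -EFinB lee_fin.
  have := dotv_le_dual SY SY_posdef r ys; rewrite dotvC -/rho mulrC.
  by lra.
move=> beta ydot beta0 Yydot.
have Yall z : closure (edom (fconj g)) z by rewrite Y_full.
rewrite /=; set SS := smooth_resid _ _ _ _ _ _ _.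
have gle (y : 'cV[R]_m) : (fconj g y <= (dotv y c)%:E)%E.
  by rewrite gE fconj_delta1.
have gb y := smooth_g_ge SY g pY LY beta (A *m x) ydot g_proper pY_prox Yydot
  y _ (gle y).
have LY0 : 0 < LY by lra.
set a := wnorm SY (ys - ydot).
have SSge : ((rho ^+ 2 / (2 * (beta * LY)) - rho * a)%:E <= SS)%E.
  have [w wrho rw] := dual_wnorm_attained SY SY_posdef r.
  rewrite -/rho in wrho rw.
  (* The maximizer of dotv r y - beta * LY / 2 * wnorm SY (y - ydot) ^+ 2. *)
  pose y := ydot + (beta * LY)^-1 *: w.
  apply: (smooth_resid_ge f g A pY beta x ydot p _ _ f_proper pE (gb y)).
  move=> fx /lagrx fxge.
  have := rbregman_le SY pY (closure (edom (fconj g))) LY y ydot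
    SY_posdef (fun t => Yall _) pYdiff pYlip.
  have -> : y - ydot = (beta * LY)^-1 *: w by rewrite /y addrC addKr.
  have bL0 : 0 < beta * LY by rewrite mulr_gt0.
  rewrite wnormZ wrho gtr0_norm ?invr_gt0// -(ler_pM2l beta0).
  have -> : beta * (2^-1 * LY * ((beta * LY)^-1 * rho) ^+ 2) =
      rho ^+ 2 / (2 * (beta * LY)) by field; rewrite !gt_eqF.
  move=> breg.
  have lin : dotv (A *m x) y - dotv y c =
      dotv r ydot + 2 * (rho ^+ 2 / (2 * (beta * LY))).
    have -> : dotv (A *m x) y - dotv y c = dotv r y.
      by rewrite /r dotvBl (dotvC y).
    by rewrite /y dotvDr dotvZr rw; field; rewrite !gt_eqF.
  have := dotv_le_dual SY SY_posdef r (ys - ydot).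
  rewrite -/rho -/a dotvBr (dotvC r ys); lra.
have k0 : (0 < (2 / LY / beta)%:E)%E.
  by rewrite lte_fin mulr_gt0 ?invr_gt0// mulr_gt0 ?invr_gt0.
have bL0 : (0 < (beta * LY)%:E)%E by rewrite lte_fin mulr_gt0.
split.
- rewrite bregmanE; [|exact: pYN|exact: pYdom|exact: pYdom].
  have Sge a' : f x = a'%:E -> ((a' - p + dotv ys r
      - beta * rbregman pY ys ydot)%:E <= SS)%E.
    move=> fx; apply: (smooth_resid_ge f g A pY beta x ydot p _ _ f_proper pE
      (gb ys)) => a2; rewrite fx => -[<-].
    by rewrite /r dotvBr (dotvC (A *m x)); lra.
  have Sy : f x = +oo%E -> SS = +oo%E.
    move=> fx; apply: eq_infty => t.
    by apply: (smooth_resid_ge f g A pY beta x ydot p _ _ f_proper pE (gb ys));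
      rewrite fx.
  move: fxN Sge Sy; case: (f x) => [fx _ /(_ _ erefl) + _|_ _ /(_ erefl) ->|]//.
    case: SS {SSge} => [s||]//; last by move=> _; rewrite -EFinM !addye// leey.
    by rewrite -EFinM -!EFinB -EFinD !lee_fin; lra.
- case: (SS) SSge => [s||]//; last by rewrite gt0_muley// addey// leey.
  rewrite lee_fin => /(quadratic_bound _ _ _ _ (mulr_gt0 beta0 LY0)).
  rewrite dual_wnorm_ge0// => /(_ isT)[].
  by rewrite invfM (mulrC beta^-1) mulrA -EFinM -EFinD lee_fin.
- case: (SS) SSge => [s||]//; last first.
    by move=> _; rewrite gt0_muley// addey//= gt0_muley// leey.
  rewrite lee_fin => /(quadratic_bound _ _ _ _ (mulr_gt0 beta0 LY0)).
  rewrite dual_wnorm_ge0// => /(_ isT)[_].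
  by rewrite invfM (mulrC beta^-1) mulrA -EFinM lee_fin.
Qed.
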